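(* Let $m,n\in\mathbb{N}$ (natural numbers, including $0$). For any formula $\psi\in\mathsf{MF}$, the following are equivalent: 1. $\mathbf{N}^+\mathbf{A}_{m,n}\vdash\psi$. 2. $\psi$ is valid on every $(m,n)$-accessible $\mathbf{N}$-frame. 3. $\psi$ is valid on every finite $(m,n)$-accessible $\mathbf{N}$-frame. 4. $\psi$ is valid on every finite $\mathrm{Sub}(\psi)$-$(m,n)$-accessible $\mathbf{N}$-frame.
   Context: Language: modal formulae are built from propositional variables (the set $\mathsf{PropVar}$), the constant $\bot$, $\neg$, $\lor$, and $\Box$; $\varphi\to\psi$ abbreviates $\neg\varphi\lor\psi$, and $\top,\land,\Diamond$ are the usual abbreviations. $\mathsf{MF}$ is the set of all formulae, $\mathrm{Sub}(\psi)$ is the set of all subformulae of $\psi$, $\Box^0\varphi=\varphi$ and $\Box^{k+1}\varphi=\Box\Box^k\varphi$. Logics: $\mathbf{N}$ has as axioms all propositional tautologies in the modal language and as rules modus ponens and necessitation (from $\varphi$ infer $\Box\varphi$). $\mathbf{N}\mathbf{A}_{m,n}$ is $\mathbf{N}$ plus the axiom scheme $\Box^n\varphi\to\Box^m\varphi$ (all $\varphi\in\mathsf{MF}$). $\mathbf{N}^+\mathbf{A}_{m,n}$ is $\mathbf{N}\mathbf{A}_{m,n}$ plus the rule $\mathrm{Ros}^\Box$: from $\neg\Box\varphi$ infer $\neg\Box\Box\varphi$. Semantics: an $\mathbf{N}$-frame is $(W,\{\prec_\varphi\}_{\varphi\in\mathsf{MF}})$ with $W$ a non-empty set and $\prec_\varphi$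 a binary relation on $W$ for each $\varphi\in\mathsf{MF}$; it is finite if $W$ is finite. An $\mathbf{N}$-model based on it adds a valuation $V:W\times\mathsf{PropVar}\to\{0,1\}$. Satisfaction: $w\Vdash p$ iff $V(w,p)=1$; $w\nVdash\bot$; $\neg,\lor$ as usual; $w\Vdash\Box\varphi$ iff $w'\Vdash\varphi$ for every $w'\in W$ with $w\prec_\varphi w'$. A formula is valid in a model if it is satisfied at every $w\in W$, and valid on a frame if it is valid in every model based on it. Accessibility: define $x\prec_\varphi^0 y$ iff $x=y$, and for $k\ge1$, $x\prec_\varphi^k y$ iff there is $w\in W$ with $x\prec_{\Box^{k-1}\varphi}w$ and $w\prec_\varphi^{k-1}y$. A frame is $\varphi$-$(m,n)$-accessible if for all $x,y\in W$, $x\prec_\varphi^m y$ implies $x\prec_\varphi^n y$. For $\Gamma\subseteq\mathsf{MF}$, it is $\Gamma$-$(m,n)$-accessible if it is $\varphi$-$(m,n)$-accessible for every $\varphi\in\mathsf{MF}$ with $\Box^m\varphi\in\Gamma$. It is $(m,n)$-accessible if it is $\mathsf{MF}$-$(m,n)$-accessible. *)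

(* Defs.v *)
From Stdlib Require Import Bool List FinFun.

Set Implicit Arguments.

Inductive form (P : Type) : Type :=
| Var : P -> form P
| Bot : form P
| Neg : form P -> form P
| Or  : form P -> form P -> form P
| Box : form P -> form P.

Arguments Bot {P}.

Definition Imp {P : Type} (phi psi : form P) : form P := Or (Neg phi) psi.

Fixpoint BoxN {P : Type} (k : nat) (phi : form P) : form P :=
  match k with
  | 0 => phi
  | S k' => Box (BoxN k' phi)
  end.

(* [Sub psi phi] : phi belongs to Sub(psi). *)
Inductive Sub {P : Type} : form P -> form P -> Prop :=
| Sub_refl : forall phi, Sub phi phi
| Sub_neg  : forall psi phi, Sub psi phi -> Sub (Neg psi) phi
| Sub_orl  : forall psi1 psi2 phi, Sub psi1 phi -> Sub (Or psi1 psi2) phi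
| Sub_orr  : forall psi1 psi2 phi, Sub psi2 phi -> Sub (Or psi1 psi2) phi
| Sub_box  : forall psi phi, Sub psi phi -> Sub (Box psi) phi.

(* Propositional evaluation: variables and boxed formulae are the atoms, whose
   truth values are given by [v] (only the values of [v] at those are used). *)
Fixpoint prop_eval {P : Type} (v : form P -> bool) (phi : form P) : bool :=
  match phi with
  | Var _ => v phi
  | Bot => false
  | Neg a => negb (prop_eval v a)
  | Or a b => orb (prop_eval v a) (prop_eval v b)
  | Box _ => v phi
  end.

Definition tautology {P : Type} (phi : form P) : Prop :=
  forall v : form P -> bool, prop_eval v phi = true.

(* Theorems of the logic N^+A_{m,n}. *)
Inductive NplusA {P : Type} (m n : nat) : form P -> Prop :=
| NplusA_taut : forall phi, tautology phi -> NplusA m n phi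
| NplusA_acc  : forall phi, NplusA m n (Imp (BoxN n phi) (BoxN m phi))
| NplusA_mp   : forall phi psi,
    NplusA m n (Imp phi psi) -> NplusA m n phi -> NplusA m n psi
| NplusA_nec  : forall phi, NplusA m n phi -> NplusA m n (Box phi)
| NplusA_ros  : forall phi,
    NplusA m n (Neg (Box phi)) -> NplusA m n (Neg (Box (Box phi))).

Record frame (P : Type) : Type := Frame {
  world :> Type;
  world_nonempty : inhabited world;
  rel : form P -> world -> world -> Prop
}.

Arguments rel {P} f _ _ _.

Definition finite_frame {P : Type} (F : frame P) : Prop := Finite (world F).

Record model (P : Type) : Type := Model {
  base :> frame P;
  valuation : base -> P -> bool
}.

Arguments Model {P} base valuation.
Arguments valuation {P} m _ _.

Fixpoint sat {P : Type} (M : model P) (w : M) (phi : form P) : Prop :=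
  match phi with
  | Var p => valuation M w p = true
  | Bot => False
  | Neg a => ~ sat M w a
  | Or a b => sat M w a \/ sat M w b
  | Box a => forall w' : M, rel M a w w' -> sat M w' a
  end.

Definition valid_in_model {P : Type} (M : model P) (phi : form P) : Prop :=
  forall w : M, sat M w phi.

Definition valid_on_frame {P : Type} (F : frame P) (phi : form P) : Prop :=
  forall V : F -> P -> bool, valid_in_model (Model F V) phi.

Fixpoint relN {P : Type} (F : frame P) (phi : form P) (k : nat) (x y : F) : Prop :=
  match k with
  | 0 => x = y
  | S k' => exists w : F, rel F (BoxN k' phi) x w /\ relN F phi k' w y
  end.

Definition formula_accessible {P : Type} (m n : nat) (F : frame P)
    (phi : form P) : Prop :=
  forall x y : F, relN F phi m x y -> relN F phi n x y.

Definition set_accessible {P : Type} (Gamma : form P -> Prop) (m n : nat)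
    (F : frame P) : Prop :=
  forall phi : form P, Gamma (BoxN m phi) -> formula_accessible m n F phi.

Definition accessible {P : Type} (m n : nat) (F : frame P) : Prop :=
  set_accessible (fun _ : form P => True) m n F.

(* Main.v *)
(** An unprovable formula always has a valuation refuting it that respects any
    given finite set of theorems. For [n > 0] (or [m = 0]) such valuations,
    restricted to Sub(psi), are the worlds of a finite canonical model, where Ros
    provides the intermediate points of accessibility paths.
    For [n = 0 < m] every path of length m must return to its start. There each
    false [Box theta] at a world is witnessed along a cycle of m worlds, all the
    boxed formulas over one unboxed [phi] and one residue mod m sharing a cycle;
    the new worlds only care about Sub(phi), so the tree of cycles is finite. *)

From Stdlib Require Import Bool List FinFun Arith Lia Classical ClassicalEpsilon.
From Stdlib Require Import ProofIrrelevance.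
Require Import Defs.

Set Implicit Arguments.

(** * Formulas *)

Section Formulas.
Variable P : Type.
Implicit Types phi psi chi theta : form P.

Fixpoint size phi : nat :=
  match phi with
  | Var _ | Bot => 1
  | Neg a => S (size a)
  | Or a b => S (size a + size b)
  | Box a => S (size a)
  end.

Fixpoint subs phi : list (form P) :=
  phi :: match phi with
         | Var _ | Bot => nil
         | Neg a => subs a
         | Or a b => subs a ++ subs b
         | Box a => subs a
         end.

Lemma in_subs phi chi : In chi (subs phi) <-> Sub phi chi.
Proof.
  split.
  - induction phi; simpl; intros H;
      repeat match goal with
      | H : _ \/ _ |- _ => destruct H
      | H : In _ (_ ++ _) |- _ => apply in_app_or in H
      | H : False |- _ => contradiction
      end; subst; auto using Sub.
  - induction 1; simpl; rewrite ?in_app_iff; auto.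
    destruct phi; simpl; auto.
Qed.

Lemma Sub_trans phi chi theta : Sub phi chi -> Sub chi theta -> Sub phi theta.
Proof. induction 1; auto using Sub. Qed.

Lemma Sub_size phi chi : Sub phi chi -> size chi <= size phi.
Proof. induction 1; simpl; lia. Qed.

Lemma Sub_Neg phi chi : Sub phi (Neg chi) -> Sub phi chi.
Proof. intros H; apply (Sub_trans H); auto using Sub. Qed.

Lemma Sub_Or phi chi1 chi2 : Sub phi (Or chi1 chi2) -> Sub phi chi1 /\ Sub phi chi2.
Proof. intros H; split; apply (Sub_trans H); auto using Sub. Qed.

Lemma Sub_Box phi chi : Sub phi (Box chi) -> Sub phi chi.
Proof. intros H; apply (Sub_trans H); auto using Sub. Qed.

Lemma BoxN_add j k phi : BoxN j (BoxN k phi) = BoxN (j + k) phi.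
Proof. induction j; simpl; congruence. Qed.

Lemma BoxN_Box k phi : BoxN k (Box phi) = Box (BoxN k phi).
Proof. induction k; simpl; congruence. Qed.

Lemma size_BoxN k phi : size (BoxN k phi) = k + size phi.
Proof. induction k; simpl; congruence. Qed.

Lemma Sub_BoxN_le phi chi j k :
  j <= k -> Sub phi (BoxN k chi) -> Sub phi (BoxN j chi).
Proof. induction 1; simpl; auto using Sub_Box. Qed.

(** A formula splits uniquely as [depth] boxes over an unboxed [base]; cycles are indexed by that
    base and a residue of the number of boxes. *)
Fixpoint base phi : form P := match phi with Box a => base a | _ => phi end.

Fixpoint depth phi : nat := match phi with Box a => S (depth a) | _ => 0 end.

Lemma BoxN_depth phi : BoxN (depth phi) (base phi) = phi.
Proof. induction phi; simpl; congruence. Qed.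

Lemma base_BoxN k phi : base (BoxN k phi) = base phi.
Proof. induction k; simpl; auto. Qed.

Lemma depth_BoxN k phi : depth (BoxN k phi) = k + depth phi.
Proof. induction k; simpl; auto. Qed.

Lemma base_base phi : base (base phi) = base phi.
Proof. induction phi; simpl; auto. Qed.

Lemma depth_base phi : depth (base phi) = 0.
Proof. induction phi; simpl; auto. Qed.

Lemma size_base phi : size (base phi) <= size phi.
Proof. induction phi; simpl; lia. Qed.

(** Left inverse of [BoxN k]; it lets the axiom instances ending in a member of Sub(psi) be
    listed. *)
Fixpoint strip k phi : form P :=
  match k, phi with S k', Box a => strip k' a | _, _ => phi end.

Lemma strip_BoxN k phi : strip k (BoxN k phi) = phi.
Proof. induction k; simpl; auto. Qed.

End Formulas.

Lemma Finite_sig (A : Type) (Q : A -> Prop) (l : list A) :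
  (forall a, Q a -> In a l) -> Finite {a | Q a}.
Proof.
  intros H.
  (* The hypothesis that [l] covers [Q] is lost on the tail of [l], so the induction only collects
     the elements whose projection lies in [l]. *)
  enough (K : exists l' : list {a | Q a}, forall x, In (proj1_sig x) l -> In x l').
  { destruct K as [l' K]. exists l'. intros x. apply K, H, proj2_sig. }
  clear H. induction l as [|a l [l' IH]].
  - exists nil. simpl. tauto.
  - destruct (classic (Q a)) as [q|q].
    + exists (exist Q a q :: l'). intros [b qb] [E|E]; simpl in E.
      * subst b. left. f_equal. apply proof_irrelevance.
      * right. apply IH, E.
    + exists l'. intros [b qb] [E|E]; simpl in E.
      * subst b. contradiction.
      * apply IH, E.
Qed.

(** * Semantics *)

Section Semantics.
Variable P : Type.
Implicit Types phi psi chi theta : form P.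

Lemma sat_BoxN (M : model P) k phi : forall w : M,
  sat M w (BoxN k phi) <-> forall y, relN M phi k w y -> sat M y phi.
Proof.
  induction k; simpl; intros w.
  - split; [intros H y <-; auto | auto].
  - split.
    + intros H y [x [R K]]. apply (IHk x); auto.
    + intros H x R. apply IHk. intros y K. apply H. eauto.
Qed.

Definition reframe (F : frame P) (R : form P -> F -> F -> Prop) : frame P :=
  Frame (world_nonempty F) R.

Lemma sat_reframe (F : frame P) R psi V :
  (forall theta x y, Sub psi (Box theta) -> (R theta x y <-> rel F theta x y)) ->
  forall chi (w : F), Sub psi chi ->
    (sat (Model (reframe F R) V) w chi <-> sat (Model F V) w chi).
Proof.
  intros HR. induction chi; intros w S; simpl; try tauto.
  - rewrite (IHchi w (Sub_Neg S)). tauto.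
  - destruct (Sub_Or S) as [S1 S2]. rewrite (IHchi1 w S1), (IHchi2 w S2). tauto.
  - split; intros H w' K; apply IHchi; eauto using Sub_Box; apply H, HR; auto.
Qed.

Lemma relN_reframe_Sub (F : frame P) R psi phi k :
  (forall theta x y, Sub psi (Box theta) -> (R theta x y <-> rel F theta x y)) ->
  Sub psi (BoxN k phi) ->
  forall x y : F, relN (reframe F R) phi k x y <-> relN F phi k x y.
Proof.
  intros HR. induction k; simpl; intros S x y; [tauto|].
  split; intros [w [H K]]; exists w; split; try (apply HR; auto; fail);
    apply IHk; auto using Sub_Box.
Qed.

Lemma relN_reframe_mono (F : frame P) (R : form P -> F -> F -> Prop) phi k :
  (forall theta x y, rel F theta x y -> R theta x y) ->
  forall x y : F, relN F phi k x y -> relN (reframe F R) phi k x y.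
Proof.
  intros HR. induction k; simpl; intros x y; auto.
  intros [w [H K]]; exists w; auto.
Qed.

(* The relations for formulas [theta] with [Box theta] outside Sub(psi) are
   irrelevant for psi: making them total helps when [m <= n], and making them
   empty helps when [n < m]. *)
Lemma accessible_completion (F : frame P) m n psi :
  set_accessible (Sub psi) m n F ->
  exists R : form P -> F -> F -> Prop,
    accessible m n (reframe F R) /\
    forall theta x y, Sub psi (Box theta) -> (R theta x y <-> rel F theta x y).
Proof.
  intros acc. destruct (le_lt_dec m n) as [le|lt].
  - exists (fun theta x y => Sub psi (Box theta) -> rel F theta x y).
    split; [|tauto]. intros phi _ x y H.
    destruct (classic (Sub psi (BoxN m phi))) as [S|S].
    + apply relN_reframe_mono; [auto|]. apply acc; auto.
      revert H; apply relN_reframe_Sub with (psi := psi); auto; tauto.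
    (* No [BoxN k phi] with [k >= m] lies in Sub(psi), so the [n - m] extra steps can loop at [x]
       before the given path is followed. *)
    + induction le as [|n' le IH]; auto.
      exists x. split.
      * intros S'. destruct S. apply Sub_BoxN_le with (k := S n'); auto.
      * clear acc IH. induction le as [|n'' le IH]; auto.
        exists x. split; auto.
        intros S'. destruct S. apply Sub_BoxN_le with (k := S n''); auto.
  - exists (fun theta x y => Sub psi (Box theta) /\ rel F theta x y).
    split; [|tauto]. intros phi _ x y H.
    destruct (classic (Sub psi (BoxN m phi))) as [S|S].
    + apply relN_reframe_Sub with (psi := psi); try tauto.
      { apply Sub_BoxN_le with (k := m); auto with arith. }
      apply acc; auto.
      revert H; apply relN_reframe_Sub with (psi := psi); auto; tauto.
    + destruct m; [lia|]. destruct H as [w [[S' _] _]]. contradiction.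
Qed.

Lemma valid_accessible_Sub m n psi :
  (forall F : frame P, finite_frame F -> accessible m n F -> valid_on_frame F psi) ->
  forall F : frame P, finite_frame F -> set_accessible (Sub psi) m n F ->
    valid_on_frame F psi.
Proof.
  intros H F fin acc V w.
  destruct (accessible_completion acc) as [R [accR HR]].
  apply (sat_reframe F R V HR w (Sub_refl psi)).
  apply (H (reframe F R)); auto.
Qed.

(** * Soundness *)

Lemma tautology_valid (M : model P) phi : tautology phi -> valid_in_model M phi.
Proof.
  intros T w.
  set (v := fun chi => if excluded_middle_informative (sat M w chi) then true else false).
  enough (E : forall chi, prop_eval v chi = true <-> sat M w chi) by apply E, T.
  assert (Ev : forall chi, v chi = true <-> sat M w chi).
  { intros chi. unfold v. destruct excluded_middle_informative; intuition congruence. }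
  induction chi; simpl prop_eval; try apply Ev; simpl.
  - intuition discriminate.
  - rewrite negb_true_iff, <- not_true_iff_false. tauto.
  - rewrite orb_true_iff. tauto.
Qed.

Definition empty_frame : frame P :=
  Frame (inhabits tt) (fun (_ : form P) (_ _ : unit) => False).

(* The world [false] sees nothing along formulas that are not k-fold boxes, and
   returns to itself in k+1 steps through the world [true], which sees everything. *)
Definition return_frame k : frame P :=
  Frame (inhabits true)
    (fun theta x y => x = true \/ ((exists chi, theta = BoxN k chi) /\ y = true)).

Lemma return_frame_accessible k : 0 < k -> accessible 0 (S k) (return_frame k).
Proof.
  intros Hk phi _ x y <-. exists true. split; [right; eauto|].
  assert (H : forall j y, 0 < j -> relN (return_frame k) phi j true y).
  { induction j as [|j IH]; [lia|]. intros z _. destruct j.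
    - exists z. simpl; auto.
    - exists true. split; [left; auto|]. apply IH; lia. }
  auto.
Qed.

(* The rule is vacuous unless [m = 0 < n] and [phi] is an (n-1)-fold box:
   otherwise some accessible frame has a world seeing nothing along [phi]. *)
Lemma ros_valid m n phi :
  (forall F : frame P, accessible m n F -> valid_on_frame F (Neg (Box phi))) ->
  forall F : frame P, accessible m n F -> valid_on_frame F (Neg (Box (Box phi))).
Proof.
  intros H F acc V w Hw.
  assert (K : forall E : frame P, accessible m n E ->
            exists V : E -> P -> bool, forall x : E, ~ sat (Model E V) x (Box phi)).
  { intros E accE. exists (fun _ _ => true). apply H; auto. }
  destruct m.
  - destruct n.
    + destruct (K empty_frame) as [V' K']; [intros ? _ ? ? ?; auto|].
      apply (K' tt). intros ? [].
    + destruct (classic (exists chi, phi = BoxN n chi)) as [[chi ->]|N].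
      * destruct (acc (Box chi) I w w eq_refl) as [y [R _]].
        rewrite BoxN_Box in R. exact (H F acc V y (Hw y R)).
      * destruct n; [destruct N; exists phi; reflexivity|].
        destruct (K (return_frame (S n))) as [V' K'].
        { apply return_frame_accessible; lia. }
        apply (K' false). intros y [R|[R _]]; [discriminate|contradiction].
  - destruct (K empty_frame) as [V' K'].
    { intros ? _ ? ? [? [[] _]]. }
    apply (K' tt). intros ? [].
Qed.

Theorem soundness m n phi : NplusA m n phi ->
  forall F : frame P, accessible m n F -> valid_on_frame F phi.
Proof.
  induction 1; intros F acc.
  - intros V. apply tautology_valid; auto.
  - intros V w. simpl.
    destruct (classic (sat (Model F V) w (BoxN n phi))) as [K|K]; auto.
    right. rewrite sat_BoxN in *. intros y R. apply K. apply acc; auto.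
  - intros V w. destruct (IHNplusA1 F acc V w); auto.
    contradiction (IHNplusA2 F acc V w).
  - intros V w y _. apply IHNplusA; auto.
  - apply ros_valid with (m := m) (n := n); auto.
Qed.

End Semantics.

(** * Completeness *)

Section Completeness.
Variable P : Type.
Variables m n : nat.
Implicit Types phi psi chi theta : form P.

Lemma NplusA_BoxN_le j k phi :
  j <= k -> NplusA m n (BoxN j phi) -> NplusA m n (BoxN k phi).
Proof. induction 1; simpl; auto using NplusA_nec. Qed.

(** Each theorem [h] of the list is moved into the antecedent: by modus ponens [h -> phi] stays
    unprovable, and an unprovable formula is no tautology. *)
Lemma refuting_valuation (H : list (form P)) : forall phi, ~ NplusA m n phi ->
  exists v, prop_eval v phi = false /\
    forall h, In h H -> NplusA m n h -> prop_eval v h = true.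
Proof.
  induction H as [|h H IH]; intros phi Hphi.
  - apply NNPP. intros N. apply Hphi, NplusA_taut. intros v.
    apply not_false_iff_true. intros E. apply N. exists v. simpl. tauto.
  - destruct (classic (NplusA m n h)) as [Hh|Hh].
    + destruct (IH (Imp h phi)) as [v [E K]].
      { intros N. apply Hphi. apply NplusA_mp with h; auto. }
      simpl in E. apply orb_false_iff in E. destruct E as [E1 E2].
      apply negb_false_iff in E1.
      exists v. split; auto. intros g [<-|G]; auto.
    + destruct (IH phi Hphi) as [v [E K]]. exists v. split; auto.
      intros g [<-|G]; auto; contradiction.
Qed.

(** The three blocks serve necessitation, Ros and the axiom scheme. If [chi] is not an m-fold box,
    its entry in the third block binds a valuation only when provable. *)
Definition relevant psi : list (form P) :=
  subs psi ++ map (@Neg P) (subs psi)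
    ++ map (fun chi => Imp (BoxN n (strip m chi)) chi) (subs psi).

Definition admissible psi (v : form P -> bool) : Prop :=
  forall h, In h (relevant psi) -> NplusA m n h -> prop_eval v h = true.

Section Admissible.
Variable psi : form P.
Variable v : form P -> bool.
Hypothesis adm : admissible psi v.

Lemma admissible_thm chi :
  Sub psi chi -> NplusA m n chi -> prop_eval v chi = true.
Proof. intros S. apply adm. apply in_app_iff. left. apply in_subs, S. Qed.

Lemma admissible_neg chi :
  Sub psi chi -> NplusA m n (Neg chi) -> prop_eval v chi = false.
Proof.
  intros S H. apply negb_true_iff. apply (adm (h := Neg chi)); auto.
  unfold relevant. rewrite !in_app_iff. right; left.
  apply in_map, in_subs, S.
Qed.

Lemma admissible_acc chi :
  Sub psi (BoxN m chi) -> prop_eval v (BoxN n chi) = true ->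
  prop_eval v (BoxN m chi) = true.
Proof.
  intros S H.
  assert (K : prop_eval v (Imp (BoxN n chi) (BoxN m chi)) = true).
  { apply adm; [|apply NplusA_acc]. unfold relevant. rewrite !in_app_iff. right; right.
    apply in_map_iff. exists (BoxN m chi). rewrite strip_BoxN. split; auto.
    apply in_subs, S. }
  simpl in K. rewrite H in K. exact K.
Qed.

End Admissible.

(** ** The canonical model, for [n > 0] or [m = 0] *)

Section Canonical.
Variable psi : form P.
Hypothesis unprovable : ~ NplusA m n psi.

(** Only the values on Sub(psi) are kept, as a filtered list, so that there are finitely many
    worlds. *)
Definition truth_set (s : list (form P)) : Prop :=
  exists v, admissible psi v /\ s = filter (prop_eval v) (subs psi).

Definition cworld := {s | truth_set s}.
Definition holds (x : cworld) phi : Prop := In phi (proj1_sig x).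

Lemma cworld_valuation (x : cworld) :
  exists v, admissible psi v /\
    forall phi, holds x phi <-> Sub psi phi /\ prop_eval v phi = true.
Proof.
  destruct x as [s [v [A ->]]]. exists v. split; auto.
  intros phi. unfold holds; simpl. rewrite filter_In, in_subs. tauto.
Qed.

Lemma cworld_exists phi : ~ NplusA m n phi ->
  exists v, admissible psi v /\ prop_eval v phi = false /\
  exists x : cworld, forall chi, holds x chi <-> Sub psi chi /\ prop_eval v chi = true.
Proof.
  intros H. destruct (refuting_valuation (relevant psi) H) as [v [E A]].
  exists v. split; auto. split; auto.
  exists (exist truth_set (filter (prop_eval v) (subs psi))
            (ex_intro _ v (conj A eq_refl))).
  intros chi. unfold holds; simpl. rewrite filter_In, in_subs. tauto.
Qed.

Lemma cworld_inhabited : inhabited cworld.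
Proof. destruct (cworld_exists unprovable) as [v [_ [_ [x _]]]]. exact (inhabits x). Qed.

(** Only the one formula [Box phi] restricts the relation of [phi]; a world lacking it, in
    particular when it is outside Sub(psi), sees every world. *)
Definition cframe : frame P :=
  Frame cworld_inhabited (fun phi x y => holds x (Box phi) -> holds y phi).

Definition cmodel : model P :=
  Model cframe (fun x p =>
    if excluded_middle_informative (holds x (Var p)) then true else false).

Lemma filter_sublists (A : Type) (l : list A) :
  exists L, forall f, In (filter f l) L.
Proof.
  induction l as [|a l [L IH]].
  - exists (nil :: nil). simpl; auto.
  - exists (L ++ map (cons a) L). intros f. simpl. rewrite in_app_iff.
    destruct (f a); [right; apply in_map|left]; auto.
Qed.

Lemma cframe_finite : finite_frame cframe.
Proof.
  destruct (filter_sublists (subs psi)) as [L HL].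
  apply Finite_sig with L. intros s [v [_ ->]]. auto.
Qed.

Lemma canonical_truth chi : forall x : cmodel, Sub psi chi ->
  (sat cmodel x chi <-> holds x chi).
Proof.
  induction chi; intros x S; simpl.
  - destruct excluded_middle_informative; intuition congruence.
  - destruct (cworld_valuation x) as [v [_ H]]. rewrite H. simpl. intuition discriminate.
  - pose proof (Sub_Neg S) as S1. rewrite (IHchi x S1).
    destruct (cworld_valuation x) as [v [_ H]]. rewrite !H. simpl.
    rewrite negb_true_iff. destruct (prop_eval v chi); intuition discriminate.
  - destruct (Sub_Or S) as [S1 S2]. rewrite (IHchi1 x S1), (IHchi2 x S2).
    destruct (cworld_valuation x) as [v [_ H]]. rewrite !H. simpl.
    rewrite orb_true_iff. tauto.
  - pose proof (Sub_Box S) as S1. split.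
    + intros H. apply NNPP. intros N.
      (* Necessitation would otherwise put [Box chi] into [x]. Since [x] lacks it, [x] sees the
         world refuting [chi]. *)
      assert (U : ~ NplusA m n chi).
      { intros T. destruct (cworld_valuation x) as [v [A K]]. apply N, K. split; auto.
        apply (admissible_thm A S). apply NplusA_nec, T. }
      destruct (cworld_exists U) as [v [_ [E [y K]]]].
      assert (Hy : sat cmodel y chi) by (apply H; tauto).
      apply (IHchi y S1), K in Hy. destruct Hy. congruence.
    + intros H y R. apply IHchi; auto.
Qed.

Lemma canonical_relN_holds phi k : forall x y : cframe,
  relN cframe phi k x y -> holds x (BoxN k phi) -> holds y phi.
Proof.
  induction k; simpl; intros x y.
  - intros <-; auto.
  - intros [w [R K]] H. eauto.
Qed.

(* Ros guarantees a world containing [Box^k phi] whenever some world contains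
   [Box^(k+1) phi] with [k > 0]; necessitation guarantees a world omitting it
   whenever [Box^(k+1) phi] is unprovable. *)
Lemma canonical_relN phi k : 0 < k -> forall x y : cframe,
  (holds x (BoxN k phi) -> holds y phi) ->
  (~ holds y phi -> ~ NplusA m n (BoxN k phi)) ->
  relN cframe phi k x y.
Proof.
  induction k as [|k IH]; [lia|]. intros _ x y H U.
  destruct k as [|k].
  { exists y. simpl; auto. }
  enough (K : exists w : cworld, (holds x (BoxN (S (S k)) phi) -> holds w (BoxN (S k) phi))
                        /\ (holds w (BoxN (S k) phi) -> holds y phi)).
  { destruct K as [w [K1 K2]]. exists w. split; auto. apply IH; auto; [lia|].
    intros N T. apply (U N). apply NplusA_nec, T. }
  destruct (classic (holds y phi)) as [Y|Y].
  - destruct (classic (holds x (BoxN (S (S k)) phi))) as [X|X].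
    + destruct (cworld_valuation x) as [v [A E]]. apply E in X. destruct X as [S X].
      assert (T : ~ NplusA m n (Neg (BoxN (Datatypes.S k) phi))).
      { intros T. apply NplusA_ros in T. pose proof (admissible_neg A S T). congruence. }
      destruct (cworld_exists T) as [v' [_ [E' [w K]]]].
      exists w. split; auto. intros _. apply K. split; [apply (Sub_Box S)|].
      apply negb_false_iff, E'.
    + exists x. tauto.
  - assert (T : ~ NplusA m n (BoxN (S k) phi)).
    { intros T. apply (U Y). apply NplusA_nec, T. }
    destruct (cworld_exists T) as [v' [_ [E' [w K]]]].
    exists w. split; [tauto|]. rewrite K. intros [_ E]. congruence.
Qed.

(** The axiom turns [BoxN n phi] at [x], or its provability, into [BoxN m phi] at [x], which the
    given path carries to [phi] at [y]. If [n = 0], the side condition forces [m = n]. *)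
Lemma canonical_accessible : 0 < n \/ m = 0 -> set_accessible (Sub psi) m n cframe.
Proof.
  intros D phi S x y R.
  destruct (Nat.eq_dec n 0) as [n0|n0].
  { assert (E : m = n) by lia.
    exact (eq_ind m (fun k => relN cframe phi k x y) R n E). }
  pose proof (canonical_relN_holds _ _ _ _ R) as H.
  apply canonical_relN; [lia| |].
  - intros K. apply H. destruct (cworld_valuation x) as [v [A E]].
    apply E. split; auto. apply (admissible_acc A phi S). apply E, K.
  - intros Y T. apply Y, H. destruct (cworld_valuation x) as [v [A E]].
    apply E. split; auto. apply (admissible_thm A S).
    exact (NplusA_mp (NplusA_acc m n phi) T).
Qed.

Lemma canonical_refutes : exists w : cmodel, ~ sat cmodel w psi.
Proof.
  destruct (cworld_exists unprovable) as [v [_ [E [x K]]]].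
  exists x. rewrite canonical_truth by apply Sub_refl. rewrite K. intros [_ H]. congruence.
Qed.

End Canonical.
End Completeness.
(** ** The cycle model, for [n = 0 < m] *)

(* A world is a stack of visited cycles: [(phi, r, i) :: w] is the i-th point
   ([0 < i < m]) of the cycle through [w = pt w phi r 0] devoted to the formulas
   [BoxN l phi] with [l] congruent to [r] mod m, and it refutes [phi]. *)

Section Cycles.
Variable P : Type.
Variable m : nat.
Variable psi : form P.
Variable v : form P -> form P -> bool.
Implicit Types phi chi theta : form P.
Hypothesis m_pos : 0 < m.
Hypothesis v_refutes : forall phi, ~ NplusA m 0 phi -> prop_eval (v phi) phi = false.
Hypothesis v_admissible : forall phi, ~ NplusA m 0 phi -> admissible m 0 phi (v phi).
Hypothesis unprovable : ~ NplusA m 0 psi.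

Definition pworld : Type := list (form P * nat * nat).

Definition hd (w : pworld) : form P :=
  match w with nil => psi | (phi, _, _) :: _ => phi end.

Definition pt (w : pworld) phi (r i : nat) : pworld :=
  match i with 0 => w | _ => (phi, r, i) :: w end.

Definition fal phi chi : Prop := Sub phi chi /\ prop_eval (v phi) chi = false.

(** A step moves from point [i] to point [i + 1] of a cycle and removes one box. To refute
    [Box theta] at point [i], the cycle set out from [w] with [BoxN (i + 1) theta], whose depth
    gives the residue [r]; [r] is thus constant along a path. *)
Definition prel theta (a b : pworld) : Prop :=
  exists w i,
    let r := (depth theta + 1 + i) mod m in
    i < m /\ fal (hd w) (BoxN (i + 1) theta) /\
    a = pt w (base theta) r i /\ b = pt w (base theta) r ((i + 1) mod m).

Definition pframe : frame P := Frame (inhabits (nil : pworld)) prel.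
Definition pmodel : model P := Model pframe (fun w p => v (hd w) (Var p)).

Lemma fal_BoxN_unprovable phi k chi : ~ NplusA m 0 phi ->
  fal phi (BoxN k chi) -> ~ NplusA m 0 chi.
Proof.
  intros U [S E] T. pose proof (v_admissible U) as A.
  assert (T' : NplusA m 0 (BoxN k chi)).
  { apply NplusA_BoxN_le with (j := 0); auto with arith. }
  rewrite (admissible_thm A S T') in E. discriminate.
Qed.

(** The contrapositive of the axiom [chi -> BoxN m chi]: a refutation survives a full turn of the
    cycle. *)
Lemma fal_acc phi chi : ~ NplusA m 0 phi -> fal phi (BoxN m chi) -> fal phi chi.
Proof.
  intros U [S E]. pose proof (v_admissible U) as A. split.
  - apply Sub_BoxN_le with (k := m) (j := 0); auto with arith.
  - apply not_true_iff_false. intros T.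
    rewrite (admissible_acc A chi S T) in E. discriminate.
Qed.

Lemma fal_Box_size phi k chi : 0 < k -> fal phi (BoxN k chi) -> size chi < size phi.
Proof. intros K [S _]. apply Sub_size in S. rewrite size_BoxN in S. lia. Qed.

Lemma prel_intro theta w i r : i < m -> r = (depth theta + 1 + i) mod m ->
  fal (hd w) (BoxN (i + 1) theta) ->
  prel theta (pt w (base theta) r i) (pt w (base theta) r ((i + 1) mod m)).
Proof. intros H -> F. exists w, i. simpl. auto. Qed.

(** Walking along the cycle removes one box per step and ends either at [w], where [phi] is false,
    or at an interior point, whose valuation refutes [phi]. The second hypothesis is the truth lemma
    for [phi], supplied by the induction in [cycle_truth]. *)
Lemma chain_refutes phi : base phi = phi ->
  (forall w : pmodel, ~ NplusA m 0 (hd w) -> fal (hd w) phi -> ~ sat pmodel w phi) ->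
  forall l i w, i < m -> ~ NplusA m 0 (hd w) -> fal (hd w) (BoxN (l + i) phi) ->
    ~ sat pmodel (pt w phi ((l + i) mod m) i) (BoxN l phi).
Proof.
  intros B H. assert (D : depth phi = 0) by (rewrite <- B; apply depth_base).
  induction l as [|l IH]; intros i w Hi U F.
  - destruct i; [apply H; auto|]. apply H; simpl.
    + apply (fal_BoxN_unprovable _ U F).
    + split; [apply Sub_refl|]. apply v_refutes. apply (fal_BoxN_unprovable _ U F).
  - simpl. intros K.
    assert (R : prel (BoxN l phi) (pt w phi ((S l + i) mod m) i)
                  (pt w phi ((S l + i) mod m) ((i + 1) mod m))).
    { pose proof (@prel_intro (BoxN l phi) w i ((S l + i) mod m) Hi) as I.
      rewrite base_BoxN, depth_BoxN, B, D, BoxN_add in I.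
      apply I; [f_equal; lia|]. replace (i + 1 + l) with (S l + i) by lia. exact F. }
    apply K in R. destruct (Nat.eq_dec (i + 1) m) as [E|E].
    (* The cycle closes at [w]: the position resets to 0 and [fal_acc] discards the [m] boxes used
       up. *)
    + rewrite E, Nat.Div0.mod_same in R. refine (IH 0 w m_pos U _ R).
      apply fal_acc; auto. rewrite BoxN_add.
      replace (m + (l + 0)) with (S l + i) by lia. exact F.
    + rewrite (Nat.mod_small (i + 1)) in R by lia.
      refine (IH (i + 1) w _ U _ _); [lia| |].
      * replace (l + (i + 1)) with (S l + i) by lia. exact F.
      * replace (l + (i + 1)) with (S l + i) by lia. exact R.
Qed.

Lemma cycle_truth chi : forall w : pmodel, ~ NplusA m 0 (hd w) -> Sub (hd w) chi ->
  (sat pmodel w chi <-> prop_eval (v (hd w)) chi = true).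
Proof.
  (* Induction on size, since the box case needs the claim for [base theta] instead of [theta]. *)
  remember (size chi) as s eqn:Es. revert chi Es.
  induction s as [s IH] using lt_wf_ind. intros chi -> w U S.
  destruct chi as [p| |chi|chi1 chi2|theta]; simpl sat; simpl prop_eval.
  - tauto.
  - intuition discriminate.
  - rewrite (IH (size chi)); simpl; auto using Sub_Neg.
    rewrite negb_true_iff, <- not_true_iff_false. tauto.
  - destruct (Sub_Or S) as [S1 S2]. rewrite orb_true_iff.
    rewrite (IH (size chi1)), (IH (size chi2)); simpl; auto; try lia. tauto.
  - split.
    + intros H. apply not_false_iff_true. intros E.
      refine (@chain_refutes (base theta) (base_base theta) _ (depth theta + 1) 0 w _ U _ _);
        [|lia| |].
      * intros w' U' [S' E'] K.
        apply (IH (size (base theta))) in K; auto; [congruence|].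
        pose proof (size_base theta); simpl; lia.
      * replace (depth theta + 1 + 0) with (Datatypes.S (depth theta)) by lia.
        simpl. rewrite BoxN_depth. split; auto.
      * replace (depth theta + 1) with (Datatypes.S (depth theta)) by lia.
        simpl BoxN. rewrite BoxN_depth. exact H.
    (* A true [Box theta] leaves no successor along [theta]: as point 0, [w] would falsify it; as an
       interior point, [w] has head [base theta], too small to contain it. *)
    + intros E b [w' [i [Hi [F [Ha Hb]]]]]. destruct i.
      * simpl in Ha. subst w'. destruct F as [_ F]. simpl in F. congruence.
      * simpl in Ha. subst w. simpl in S. apply Sub_size in S.
        pose proof (size_base theta). simpl in S. lia.
Qed.

(** If a world were point 0 of one cycle and interior to another, its head [phi] would contain the
    larger [BoxN j phi]. *)
Lemma pt_inj w w' phi r r' i i' j j' :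
  0 < j -> fal (hd w) (BoxN j phi) -> 0 < j' -> fal (hd w') (BoxN j' phi) ->
  pt w phi r i = pt w' phi r' i' -> w = w' /\ i = i'.
Proof.
  intros J F J' F' E. apply fal_Box_size in F; auto. apply fal_Box_size in F'; auto.
  destruct i, i'; simpl in E.
  - auto.
  - subst w. simpl in F. lia.
  - subst w'. simpl in F'. lia.
  - injection E; auto.
Qed.

(** By [pt_inj] each step has only one cycle and position it can come from, so a path never leaves
    its cycle and advances one point at a time. *)
Lemma cycle_path phi w i j : 0 < j -> i < m -> fal (hd w) (BoxN j (base phi)) ->
  forall k y, 
    relN pframe phi k (pt w (base phi) ((depth phi + k + i) mod m) i) y ->
    y = pt w (base phi) ((depth phi + k + i) mod m) ((i + k) mod m).
Proof.
  intros J Hi F k. revert i Hi. induction k as [|k IH]; intros i Hi y R.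
  - rewrite (Nat.add_0_r i), (Nat.mod_small i) by lia. symmetry. exact R.
  - destruct R as [b [[w' [i' R']] R]]. simpl in R'.
    rewrite base_BoxN, depth_BoxN in R'.
    destruct R' as [Hi' [F' [Ea Eb]]].
    rewrite <- (BoxN_depth phi) in F' at 1. rewrite !BoxN_add in F'.
    apply pt_inj with (j := j) (j' := i' + 1 + k + depth phi) in Ea; auto; [|lia].
    destruct Ea as [<- <-].
    replace (k + depth phi + 1 + i) with (depth phi + S k + i) in Eb by lia.
    destruct (Nat.eq_dec (i + 1) m) as [E|E].
    + rewrite E, Nat.Div0.mod_same in Eb. simpl in Eb. subst b.
      apply (IH 0 m_pos) in R. rewrite R.
      replace (depth phi + S k + i) with (depth phi + k + 0 + 1 * m) by lia.
      replace (i + S k) with (0 + k + 1 * m) by lia.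
      rewrite !Nat.Div0.mod_add. reflexivity.
    + rewrite (Nat.mod_small (i + 1)) in Eb by lia. subst b.
      replace (depth phi + S k + i) with (depth phi + k + (i + 1)) in * by lia.
      apply (IH (i + 1)) in R; [|lia]. rewrite R. do 2 f_equal. lia.
Qed.

Lemma pframe_accessible : accessible m 0 pframe.
Proof.
  intros phi _ x y R. simpl.
  (* The first step of the path reveals the cycle and the position of [x]; [m] further points along
     is [x] again. *)
  assert (K : forall k, 0 < k -> relN pframe phi k x y ->
            exists w i j, 0 < j /\ i < m /\ fal (hd w) (BoxN j (base phi)) /\
              x = pt w (base phi) ((depth phi + k + i) mod m) i).
  { intros [|k] Hk; [lia|]. intros [b [[w [i R']] _]]. simpl in R'.
    rewrite base_BoxN, depth_BoxN in R'.
    destruct R' as [Hi [F [Ea _]]].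
    rewrite <- (BoxN_depth phi) in F at 1. rewrite !BoxN_add in F.
    exists w, i, (i + 1 + k + depth phi).
    split; [lia|]. split; [exact Hi|]. split; [exact F|].
    rewrite Ea. do 2 f_equal. lia. }
  destruct (K m m_pos R) as [w [i [j [J [Hi [F ->]]]]]].
  apply cycle_path with (j := j) in R; auto. rewrite R.
  replace (i + m) with (i + 1 * m) by lia.
  rewrite Nat.Div0.mod_add, (Nat.mod_small i) by lia. reflexivity.
Qed.

(** * Restriction of the cycle model to finitely many stacks *)

Inductive reachable : pworld -> Prop :=
| reachable_nil : reachable nil
| reachable_cons : forall phi r i w, reachable w ->
    Sub (hd w) phi -> size phi < size (hd w) -> ~ NplusA m 0 phi ->
    r < m -> i < m -> reachable ((phi, r, i) :: w).

Lemma reachable_unprovable w : reachable w -> ~ NplusA m 0 (hd w).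
Proof. destruct 1; simpl; auto. Qed.

(** A newly pushed [base theta] occurs under at least one box in [hd w], hence is smaller, and
    necessitation makes it unprovable. *)
Lemma reachable_prel theta a b : reachable a -> prel theta a b -> reachable b.
Proof.
  intros Ra [w [i [Hi [F [-> ->]]]]].
  assert (Rw : reachable w) by (destruct i; simpl in Ra; [auto | inversion Ra; auto]).
  destruct ((i + 1) mod m) eqn:E; simpl; auto.
  rewrite <- (BoxN_depth theta) in F. rewrite BoxN_add in F.
  constructor; auto.
  - apply Sub_BoxN_le with (j := 0) (k := i + 1 + depth theta); [lia|apply F].
  - apply fal_Box_size with (k := i + 1 + depth theta); auto; lia.
  - apply (fal_BoxN_unprovable _ (reachable_unprovable Rw) F).
  - apply Nat.mod_upper_bound; lia.
  - rewrite <- E. apply Nat.mod_upper_bound; lia.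
Qed.

(** Every push shrinks the head, which pays for the added length. *)
Lemma reachable_bound w : reachable w ->
  length w + size (hd w) <= size psi /\ Sub psi (hd w) /\
  forall x, In x w -> In x (list_prod (list_prod (subs psi) (seq 0 m)) (seq 0 m)).
Proof.
  induction 1 as [|phi r i w R [IH1 [IH2 IH3]] S H U Hr Hi]; simpl.
  - repeat split; [lia | apply Sub_refl | tauto].
  - pose proof (Sub_trans IH2 S) as S'. repeat split; [lia | exact S' |].
    intros x [<-|X]; auto. rewrite !in_prod_iff, !in_seq, in_subs.
    repeat split; auto; lia.
Qed.

Lemma words_finite (A : Type) (l : list A) k :
  exists L, forall w, length w <= k -> (forall a, In a w -> In a l) -> In w L.
Proof.
  induction k as [|k [L IH]].
  - exists (nil :: nil). intros [|a w]; simpl; [auto | lia].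
  - exists (nil :: map (fun p => fst p :: snd p) (list_prod l L)).
    intros [|a w] H K; [left; auto|]. right. apply in_map_iff.
    exists (a, w). split; auto. apply in_prod; [apply K; left; auto|].
    apply IH; [simpl in H; lia|]. intros b B. apply K. right. auto.
Qed.

Definition rframe : frame P :=
  Frame (inhabits (exist reachable nil reachable_nil))
    (fun theta x y => prel theta (proj1_sig x) (proj1_sig y)).
Definition rmodel : model P :=
  Model rframe (fun x p => v (hd (proj1_sig x)) (Var p)).

Lemma rframe_finite : finite_frame rframe.
Proof.
  destruct (words_finite (list_prod (list_prod (subs psi) (seq 0 m)) (seq 0 m)) (size psi))
    as [L HL].
  apply Finite_sig with L. intros w R. destruct (reachable_bound R) as [B [_ K]].
  apply HL; auto. lia.
Qed.

Lemma rframe_relN phi k : forall x y : rframe,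
  relN rframe phi k x y -> relN pframe phi k (proj1_sig x) (proj1_sig y).
Proof.
  induction k; simpl; intros x y; [intros <-; auto|].
  intros [w [R K]]. eauto.
Qed.

(** Since [n = 0], the conclusion is an equality of worlds, which passes to the subframe. *)
Lemma rframe_accessible : accessible m 0 rframe.
Proof.
  intros phi _ x y R. apply rframe_relN, pframe_accessible in R; [|exact I].
  apply (eq_sig_hprop (fun _ => @proof_irrelevance _)). exact R.
Qed.

Lemma rmodel_sat chi : forall x : rmodel,
  sat rmodel x chi <-> sat pmodel (proj1_sig x) chi.
Proof.
  induction chi; intros x; simpl; try tauto.
  - rewrite IHchi. tauto.
  - rewrite IHchi1, IHchi2. tauto.
  - split.
    + intros H y R.
      apply (IHchi (exist reachable y (reachable_prel (proj2_sig x) R))). auto.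
    + intros H y R. apply IHchi. auto.
Qed.

Lemma cycle_refutes : exists x : rmodel, ~ sat rmodel x psi.
Proof.
  exists (exist reachable nil reachable_nil).
  rewrite rmodel_sat, cycle_truth; simpl; auto using Sub_refl.
  rewrite v_refutes; auto.
Qed.

End Cycles.

Theorem completeness (P : Type) m n (psi : form P) :
  (forall F : frame P, finite_frame F -> set_accessible (Sub psi) m n F ->
     valid_on_frame F psi) ->
  NplusA m n psi.
Proof.
  intros H. apply NNPP. intros U.
  destruct (classic (0 < n \/ m = 0)) as [D|D].
  - destruct (canonical_refutes U) as [w K]. apply K.
    apply (H (cframe U)); auto using cframe_finite, canonical_accessible.
  - assert (Hm : 0 < m) by lia. assert (n = 0) by lia. subst n. clear D.
    assert (V : forall phi : form P, exists v, ~ NplusA m 0 phi ->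
                  prop_eval v phi = false /\ admissible m 0 phi v).
    { intros phi. destruct (classic (NplusA m 0 phi)) as [T|T].
      (* Dummy value for provable formulas, so that choice yields a total [v]. *)
      - exists (fun _ => true). tauto.
      - destruct (refuting_valuation (relevant m 0 phi) T) as [v K]. exists v. auto. }
    set (v := fun phi => proj1_sig (constructive_indefinite_description _ (V phi))).
    assert (Hv : forall phi, ~ NplusA m 0 phi ->
                  prop_eval (v phi) phi = false /\ admissible m 0 phi (v phi)).
    { intros phi. unfold v. apply proj2_sig. }
    destruct (@cycle_refutes P m psi v) as [w K]; auto; try apply Hv.
    apply K. apply (H (rframe m psi v)).
    + apply rframe_finite; auto; apply Hv.
    + intros phi _. apply rframe_accessible; auto; apply Hv.
Qed.

Theorem theorem5p1 (PropVar : Type) (m n : nat) (psi : form PropVar) :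
  (NplusA m n psi <->
     (forall F : frame PropVar, accessible m n F -> valid_on_frame F psi))
  /\
  ((forall F : frame PropVar, accessible m n F -> valid_on_frame F psi) <->
     (forall F : frame PropVar,
        finite_frame F -> accessible m n F -> valid_on_frame F psi))
  /\
  ((forall F : frame PropVar,
      finite_frame F -> accessible m n F -> valid_on_frame F psi) <->
     (forall F : frame PropVar,
        finite_frame F -> set_accessible (Sub psi) m n F ->
        valid_on_frame F psi)).
Proof.
  (* The implications form the cycle 1, 2, 3, 4, 1; from 2 to 3 one restricts to finite frames. *)
  pose proof (@soundness PropVar m n psi) as H12.
  pose proof (@valid_accessible_Sub PropVar m n psi) as H34.
  pose proof (@completeness PropVar m n psi) as H41.
  repeat split; auto.
Qed.
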